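(* Let $A$ be a C*-algebra. (1) $A$ is LU if and only if $A$ has an approximate unit consisting of projections. (2) $A$ is AU if and only if $A$ has a $\ll$-increasing approximate unit consisting of projections. (3) $A$ is AU if and only if $A$ is LU and has a $\ll$-increasing approximate unit.
   Context: $A^1_+$ denotes the set of positive elements of $A$ of norm at most $1$. For $a,b\in A$, $a\ll b$ means $a=ab$. A directed set $(\Lambda,\prec)$ is a set with a transitive (not necessarily reflexive) relation $\prec$ such that for all $\lambda,\mu\in\Lambda$ there is $\nu\in\Lambda$ with $\lambda\prec\nu$ and $\mu\prec\nu$. An approximate unit of $A$ is a net $(u_\lambda)_{\lambda\in\Lambda}\subseteq A^1_+$ indexed by a directed set such that $\|a-au_\lambda\|\to 0$ for all $a\in A$. A net is $\ll$-increasing if $u_\lambda\ll u_\mu$ whenever $\lambda\prec\mu$. $A$ is almost unital (AU) if it has a family of unital C*-subalgebras, directed under inclusion, with dense union. $A$ is locally unital (LU) if for every finite $F\subseteq A$ and every $\varepsilon>0$ there is a unital C*-subalgebra $B$ of $A$ such that for every $f\in F$ there is $b\in B$ with $\|f-b\|<\varepsilon$. A unital C*-subalgebra $B\subseteq A$ is one having its own unit $1_B$, not necessarily a unit of $A$. *)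

(* Defs.v *)
From HB Require Import structures.
From mathcomp Require Import all_boot all_order all_algebra.
From mathcomp Require Import all_classical all_reals all_analysis.
From mathcomp Require Export complex.
Set Implicit Arguments.
Unset Strict Implicit.
Unset Printing Implicit Defensive.
Import Order.TTheory GRing.Theory Num.Theory numFieldNormedType.Exports.
Local Open Scope classical_set_scope.
Local Open Scope ring_scope.
Local Open Scope complex_scope.

(* MathComp rings are unital, so the product of a C*-algebra, which need not
   have a unit, is not the product of a ring structure. The norm of a
   normedModType over R[i] takes its values in R[i]; `|a| <= `|b| in R[i] means
   that the difference is a nonnegative real. *)
HB.mixin Record CompleteNormedModule_isCStarAlgebra (R : realType) A
    of CompleteNormedModule R[i] A := {
  cmul : A -> A -> A;
  cstar : A -> A;
  cmulA : associative cmul;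
  cmulDl : left_distributive cmul +%R;
  cmulDr : right_distributive cmul +%R;
  cmulZl : forall (k : R[i]) (a b : A), cmul (k *: a) b = k *: cmul a b;
  cmulZr : forall (k : R[i]) (a b : A), cmul a (k *: b) = k *: cmul a b;
  cstarD : {morph cstar : a b / a + b};
  cstarZ : forall (k : R[i]) (a : A), cstar (k *: a) = k^* *: cstar a;
  cstarM : forall a b : A, cstar (cmul a b) = cmul (cstar b) (cstar a);
  cstarK : involutive cstar;
  normr_cmul : forall a b : A, `|cmul a b| <= `|a| * `|b|;
  normr_cstar_cmul : forall a : A, `|cmul (cstar a) a| = `|a| ^+ 2
}.

#[short(type="cstarAlgType")]
HB.structure Definition CStarAlgebra (R : realType) :=
  {A of CompleteNormedModule_isCStarAlgebra R A & CompleteNormedModule R[i] A}.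

Declare Scope cstar_scope.
Delimit Scope cstar_scope with cstar.
Notation "a ** b" := (cmul a b) (at level 40, left associativity) : cstar_scope.
Local Open Scope cstar_scope.

Section CStarDefinitions.
Variables (R : realType) (A : cstarAlgType R).
Implicit Types (a b p : A) (B : set A).

Definition positive_elt a := exists b, a = cstar b ** b.

Definition positive_contraction a := positive_elt a /\ `|a| <= 1.

Definition projection p := p ** p = p /\ cstar p = p.

Definition ll a b := a = a ** b.

Definition cstar_subalgebra B :=
  [/\ closed B, B 0,
      forall (k : R[i]) a b, B a -> B b -> B (k *: a + b),
      forall a b, B a -> B b -> B (a ** b) &
      forall a, B a -> B (cstar a)].

(* The unit is that of B, not of A; the zero subalgebra is unital, with 1 = 0. *)
Definition unital_cstar_subalgebra B :=
  cstar_subalgebra B /\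
  exists2 e, B e & forall b, B b -> e ** b = b /\ b ** e = b.

Definition almost_unital :=
  exists F : set (set A),
    [/\ forall B, F B -> unital_cstar_subalgebra B,
        forall B C, F B -> F C -> exists D, [/\ F D, B `<=` D & C `<=` D] &
        dense (\bigcup_(B in F) B)].

Definition locally_unital :=
  forall (F : set A) (eps : R), finite_set F -> 0 < eps ->
    exists2 B, unital_cstar_subalgebra B &
      forall f, F f -> exists2 b, B b & `|f - b| < eps%:C.

Definition directed_rel (L : Type) (prec : L -> L -> Prop) :=
  (forall l m n, prec l m -> prec m n -> prec l n) /\
  (forall l m, exists n, prec l n /\ prec m n).

Definition tails (L : Type) (prec : L -> L -> Prop) : set_system L :=
  filter_from setT (fun l => [set m | prec l m]).

(* An empty index set, which directed_rel allows, is excluded by convergence: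
   its tails form the empty set system, which converges to nothing. The
   annotation on 0 selects the topology of R[i] as a numFieldType. *)
Definition approximate_unit (L : Type) (prec : L -> L -> Prop) (u : L -> A) :=
  [/\ directed_rel prec,
      forall l, positive_contraction (u l) &
      forall a, `|a - a ** u l| @[l --> tails prec] --> (0 : (R[i] : numFieldType))].

Definition ll_increasing (L : Type) (prec : L -> L -> Prop) (u : L -> A) :=
  forall l m, prec l m -> ll (u l) (u m).

End CStarDefinitions.

Arguments almost_unital {R} A.
Arguments locally_unital {R} A.

(* Main.v *)
Require Import Defs.
From mathcomp Require Import all_boot all_order all_algebra.
From mathcomp Require Import all_classical all_reals all_analysis.
From mathcomp Require Import lra.
Import Order.TTheory GRing.Theory Num.Theory numFieldNormedType.Exports.
Local Open Scope classical_set_scope.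
Local Open Scope ring_scope.
Local Open Scope complex_scope.
Local Open Scope cstar_scope.

(* (1) and (2) are the dictionary B |-> 1_B, p |-> p A p between unital
   subalgebras and projections. For (3), given u_l << u_m, pick a projection p
   with u_m p close to u_m, then n > m with p u_n close to p, and k > n. Put
   x = u_n p u_n and let 1 - z = (1 - u_m) (1 - x) (1 - u_m) in the unitization.
   Then z is self-adjoint and close to p, hence almost idempotent, while
   u_l z = u_l and z u_k = z. Iterating z |-> 3 z^2 - 2 z^3, a polynomial with
   fixed points 0 and 1, gives in the limit a projection q with
   u_l << q << u_k. The projections lying under some u_k, directed by <<, are
   therefore an increasing approximate unit. *)

Ltac bubble x :=
  repeat match goal with
  | |- context [@Algebra.add _ (@Algebra.add _ ?a x) ?b] =>
      assert_fails (constr_eq b x); rewrite (addrAC a x b)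
  end.

(* The loop cancels each term against its opposite, once both are moved last. *)
Ltac zmod :=
  apply/eqP; rewrite -subr_eq0 -[eqbLHS]add0r;
  rewrite ?(opprD, opprK) ?addrA;
  repeat match goal with
  | |- context [@Algebra.opp ?S ?x] =>
      bubble x; bubble (@Algebra.opp S x); rewrite addrK
  end; exact: eqxx.

Section CStar.
Variables (R : realType) (A : cstarAlgType R).
Implicit Types (a b c p q u v w x z : A).

(** * Real-valued norm and elementary identities of a C*-algebra *)

(** Norms lie in [R[i]] but are real, so taking the real part loses nothing and moves every estimate
    to the ordered field [R], within reach of [lra] and [nra]. *)
Definition rnorm a : R := complex.Re `|a|.

Lemma normE a : `|a| = (rnorm a)%:C.
Proof.
have := normr_ge0 a; rewrite lecE /rnorm; case: (`|a|) => r i /= /andP[/eqP-> _] //.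
Qed.

Lemma rnorm_ge0 a : 0 <= rnorm a.
Proof. by rewrite -lecR -normE normr_ge0. Qed.

Lemma rnormD a b : rnorm (a + b) <= rnorm a + rnorm b.
Proof. by rewrite -lecR rmorphD /= -!normE ler_normD. Qed.

Lemma rnormN a : rnorm (- a) = rnorm a.
Proof. by rewrite /rnorm normrN. Qed.

Lemma rnorm_dist a b : rnorm (a - b) = rnorm (b - a).
Proof. by rewrite -rnormN opprB. Qed.

Lemma rnormB a b : rnorm (a - b) <= rnorm a + rnorm b.
Proof. by rewrite -(rnormN b) rnormD. Qed.

Lemma rnorm_tri c a b : rnorm (a - b) <= rnorm (a - c) + rnorm (c - b).
Proof. by apply: le_trans (rnormD _ _); rewrite subrKA. Qed.

Lemma rnormM a b : rnorm (a ** b) <= rnorm a * rnorm b.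
Proof. by rewrite -lecR rmorphM /= -!normE normr_cmul. Qed.

Lemma rnorm_cstarM a : rnorm (cstar a ** a) = rnorm a ^+ 2.
Proof. by apply: complexI; rewrite rmorphXn /= -!normE normr_cstar_cmul. Qed.

Lemma rnorm_eq0 a : rnorm a <= 0 -> a = 0.
Proof.
move=> a0; apply: normr0_eq0; rewrite normE.
by rewrite (le_anti (introT andP (conj a0 (rnorm_ge0 a)))).
Qed.

Lemma rnorm_eq a b : (forall e : R, 0 < e -> rnorm (a - b) <= e) -> a = b.
Proof.
move=> h; apply/subr0_eq/rnorm_eq0/ler_addgt0Pl => e /h; by rewrite addr0.
Qed.

Lemma cmul0l a : (0 : A) ** a = 0.
Proof. by have := cmulZl 0 (0 : A) a; rewrite !scale0r. Qed.

Lemma cmul0r a : a ** (0 : A) = 0.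
Proof. by have := cmulZr 0 a (0 : A); rewrite !scale0r. Qed.

Lemma cmulNl a b : (- a) ** b = - (a ** b).
Proof. by have := cmulZl (-1) a b; rewrite !scaleN1r. Qed.

Lemma cmulNr a b : a ** (- b) = - (a ** b).
Proof. by have := cmulZr (-1) a b; rewrite !scaleN1r. Qed.

Lemma cmulBl a b c : (a - b) ** c = a ** c - b ** c.
Proof. by rewrite cmulDl cmulNl. Qed.

Lemma cmulBr a b c : c ** (a - b) = c ** a - c ** b.
Proof. by rewrite cmulDr cmulNr. Qed.

Lemma cstarN a : cstar (- a) = - cstar a.
Proof.
have c0 : cstar (0 : A) = 0 by apply: (addrI (cstar 0)); rewrite -cstarD !addr0.
by apply/eqP; rewrite -subr_eq0 opprK -cstarD addNr c0.
Qed.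

Lemma cstarB a b : cstar (a - b) = cstar a - cstar b.
Proof. by rewrite cstarD cstarN. Qed.

(** The C*-identity gives |b|^2 = |b* b| <= |b*| |b|; cancel |b|, then apply the bound to b* as
    well. *)
Lemma rnorm_cstar a : rnorm (cstar a) = rnorm a.
Proof.
have le b : rnorm b <= rnorm (cstar b).
  have := rnormM (cstar b) b; rewrite rnorm_cstarM expr2.
  have [/rnorm_eq0 ->|b0] := leP (rnorm b) 0; last by rewrite ler_pM2r.
  by move=> _; rewrite {1}/rnorm normr0 rnorm_ge0.
by apply/le_anti; rewrite le (le_trans (le _)) ?cstarK.
Qed.

Lemma projection_rnorm p : projection p -> rnorm p <= 1.
Proof.
case=> pp ps; have := rnorm_cstarM p; rewrite ps pp => h.
rewrite leNgt; apply/negP => p1; clear pp ps; nra.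
Qed.

Lemma projection_contraction p : projection p -> positive_contraction p.
Proof.
move=> pj; split; last by rewrite normE -[1]/(1%:C) lecR projection_rnorm.
by exists p; case: pj => pp ->; rewrite pp.
Qed.

Lemma contraction_rnorm a : positive_contraction a -> rnorm a <= 1.
Proof. by case=> _; rewrite normE -[1]/(1%:C) lecR. Qed.

Lemma contraction_cstar a : positive_contraction a -> cstar a = a.
Proof. by case=> -[b ->] _; rewrite cstarM cstarK. Qed.

(** * Newton iteration towards an idempotent *)

Definition newton_defect z := z ** z - z.

(* This is 3 z^2 - 2 z^3: Newton's method for z^2 = z squares the defect. *)
Definition newton z :=
  let d := newton_defect z in z + (d - (z ** d + z ** d)).

Lemma cmul_defectC z : newton_defect z ** z = z ** newton_defect z.
Proof. by rewrite cmulBl cmulBr cmulA. Qed.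

(** Since z, d and e = d - 2zd commute, the defect of z + e is e^2 + (d + 2ze - e). Substituting z^2
    = z + d turns the bracket into -4d^2, so only terms quadratic in the defect survive. *)
Lemma newton_defectE z d e : newton_defect z = d -> newton z - z = e ->
  newton_defect (newton z) = e ** e - (d ** d + d ** d + d ** d + d ** d).
Proof.
move=> dE eE.
have zd : d ** z = z ** d by rewrite -dE cmul_defectC.
have zz : z ** z = z + d by rewrite -dE /newton_defect; zmod.
have zzd : z ** (z ** d) = z ** d + d ** d by rewrite cmulA zz cmulDl.
have eE' : e = d - (z ** d + z ** d) by rewrite -eE /newton dE; zmod.
have ze : z ** e = z ** d - (z ** d + d ** d + (z ** d + d ** d)).
  by rewrite eE' cmulBr cmulDr zzd.
have ez : e ** z = z ** e.
  by rewrite ze eE' cmulBl cmulDl -!cmulA zd zzd.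
have -> : newton z = z + e by rewrite -eE; move: (newton z) => y; zmod.
rewrite /newton_defect cmulDl !cmulDr ez zz.
by move: (e ** e) => E; rewrite ze eE'; zmod.
Qed.

Lemma newton_cstar z : cstar z = z -> cstar (newton z) = newton z.
Proof.
move=> sz; have sd : cstar (newton_defect z) = newton_defect z.
  by rewrite cstarB cstarM sz.
rewrite /newton; move: (newton_defect z) (cmul_defectC z) sd => d zd sd /=.
by rewrite cstarD cstarB cstarD cstarM sz sd zd.
Qed.

(** If uz = u, then u annihilates the defect, and the correction added to z is a combination of d
    and zd. *)
Lemma newton_fixl u z : u ** z = u -> u ** newton z = u.
Proof.
move=> uz; have ud : u ** newton_defect z = 0 by rewrite cmulBr cmulA !uz subrr.
rewrite /newton; move: (newton_defect z) ud => d ud /=.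
by rewrite cmulDr cmulBr cmulDr cmulA uz ud addr0 subrr addr0.
Qed.

Lemma newton_fixr w z : z ** w = z -> newton z ** w = newton z.
Proof.
move=> zw; have dw : newton_defect z ** w = newton_defect z.
  by rewrite cmulBl -cmulA !zw.
rewrite /newton; move: (newton_defect z) dw => d dw /=.
by rewrite cmulDl cmulBl cmulDl -cmulA dw zw.
Qed.

(** Self-adjointness gives |z|^2 = |z^2| <= |z| + r, hence |z| <= 2. The step d - 2zd is then at
    most r + 4r, and the new defect at most 25r^2 + 4r^2, which is below r/2 as 29/64 < 1/2. *)
Lemma newton_estimate z (r := rnorm (newton_defect z)) :
  cstar z = z -> r <= 64^-1 ->
  rnorm (newton z - z) <= 5 * r /\ rnorm (newton_defect (newton z)) <= r / 2.
Proof.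
move=> sz r64; have r0 : 0 <= r := rnorm_ge0 _.
have z0 := rnorm_ge0 z.
have z2 : rnorm z <= 2.
  have : rnorm z ^+ 2 <= rnorm z + r.
    rewrite -rnorm_cstarM sz; have -> : z ** z = z + newton_defect z.
      by rewrite /newton_defect; zmod.
    exact: rnormD.
  move: (rnorm z) r r64 r0 z0 => s t; clear; nra.
have le5 : rnorm (newton z - z) <= 5 * r.
  have -> : newton z - z =
      newton_defect z - (z ** newton_defect z + z ** newton_defect z).
    by rewrite /newton; move: (newton_defect z) => d /=; zmod.
  apply: le_trans (rnormB _ _) _.
  have := rnormD (z ** newton_defect z) (z ** newton_defect z).
  have : rnorm (z ** newton_defect z) <= 2 * r.
    by apply: le_trans (rnormM _ _) _; rewrite ler_wpM2r.
  rewrite -/r; move: (rnorm _) (rnorm _) => s t; clear; lra.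
split=> //; rewrite (newton_defectE _ _ _ erefl erefl).
apply: le_trans (rnormB _ _) _.
set d := newton_defect z; set e := newton z - z.
have ee : rnorm (e ** e) <= 25 * r ^+ 2.
  apply: le_trans (rnormM _ _) _; have := rnorm_ge0 e.
  move: (rnorm e) le5 => s; move: r0; clear; nra.
have dd : rnorm (d ** d) <= r ^+ 2 by rewrite expr2 rnormM.
have d2 := rnormD (d ** d) (d ** d).
have d3 := rnormD (d ** d + d ** d) (d ** d).
have d4 := rnormD (d ** d + d ** d + d ** d) (d ** d).
move: (rnorm (e ** e)) (rnorm (d ** d)) ee dd d2 d3 d4 r64 r0.
move: (rnorm _) (rnorm _) (rnorm _).
by clear; move: r => r *; nra.
Qed.

(** * Limits in norm and convergence of the Newton iterates *)

Lemma rnorm_complete (x : nat -> A) :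
  (forall e : R, 0 < e -> exists N, forall n, (N <= n)%N -> rnorm (x n - x N) < e) ->
  exists q, forall e : R, 0 < e ->
    exists N, forall n, (N <= n)%N -> rnorm (x n - q) < e.
Proof.
move=> xC; have /cauchy_cvg xq : cauchy (x n @[n --> \oo]).
  apply: cauchy_exP => e e0.
  (* The radius [e] is a positive element of [R[i]], hence real, and its real part can serve in
     [R]. *)
  have [N xN] : exists N, forall n, (N <= n)%N -> rnorm (x n - x N) < complex.Re e.
    by apply: xC; move: e0; rewrite ltcE => /andP[].
  exists (x N); exists N => // n /= Nn.
  rewrite -ball_normE /= normE ltcE /= rnorm_dist xN // andbT.
  by move: e0; rewrite ltcE => /andP[].
exists (lim (x n @[n --> \oo])) => e e0.
have /cvgrPdist_lt/(_ e%:C)[|N _ xN] := xq; first by rewrite ltcR.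
by exists N => n /xN /=; rewrite normE ltcR rnorm_dist.
Qed.

Lemma half_pow_lt (K e : R) : 0 < e -> exists N, K * 2^-1 ^+ N < e.
Proof.
move=> e0; exists (Num.bound (K / e)).
rewrite exprVn mulrC ltr_pdivrMl ?exprn_gt0 //.
by rewrite -ltr_pdivrMr // upper_nthrootP.
Qed.

Lemma rnorm_geometric_complete (x : nat -> A) :
  (forall n, rnorm (x n.+1 - x n) <= 2^-1 ^+ n) ->
  exists q, forall e : R, 0 < e ->
    exists N, forall n, (N <= n)%N -> rnorm (x n - q) < e.
Proof.
move=> dx; apply: rnorm_complete => e e0.
(* The first factor is the sum of 2^-i over i < n; keeping the subtracted term lets the induction
   close. *)
have le N n : rnorm (x (n + N)%N - x N) <= (2 - 2 * 2^-1 ^+ n) * 2^-1 ^+ N.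
  elim: n => [|n IH].
    by rewrite subrr /rnorm normr0 /= expr0 mulr1 subrr mul0r.
  apply: le_trans (rnorm_tri (x (n + N)%N) _ _) _.
  have := dx (n + N)%N; rewrite addSn exprD exprS.
  move: IH; move: (rnorm _) (rnorm _) (2^-1 ^+ n) (2^-1 ^+ N) => s t i j; clear; nra.
have [N Ne] := half_pow_lt 2 e e0.
exists N => n Nn; rewrite -(subnK Nn); apply: le_lt_trans (le _ _) (le_lt_trans _ Ne).
by rewrite ler_wpM2r ?exprn_ge0 ?invr_ge0 // lerBlDr lerDl mulr_ge0 ?exprn_ge0 ?invr_ge0.
Qed.

(** Expand a^2 - b^2 around b; the bound |a - b| <= 1 absorbs the quadratic term into a linear
    one. *)
Lemma rnorm_sqr_dist a b : rnorm (a - b) <= 1 ->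
  rnorm (a ** a - b ** b) <= rnorm (a - b) * (1 + 2 * rnorm b).
Proof.
move=> ab1.
have -> : a ** a - b ** b = (a - b) ** (a - b) + ((a - b) ** b + b ** (a - b)).
  by rewrite !(cmulBl, cmulBr); zmod.
have h1 := rnormM (a - b) (a - b); have h2 := rnormM (a - b) b.
have h3 := rnormM b (a - b); apply: le_trans (rnormD _ _) _.
have h4 := rnormD ((a - b) ** b) (b ** (a - b)).
have := rnorm_ge0 (a - b); have := rnorm_ge0 b.
move: (rnorm ((a - b) ** (a - b))) (rnorm ((a - b) ** b)) (rnorm (b ** (a - b))) h1 h2 h3 h4.
move: (rnorm ((a - b) ** b + _)) (rnorm (a - b)) (rnorm b) ab1; clear => *; nra.
Qed.

(** This carries an identity over to a limit q: it only has to hold approximately at points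
    arbitrarily near q. It will yield q* = q, q^2 = q, uq = u, qw = q and the closedness of
    corners. *)
Lemma locally_lipschitz_eq (f g : A -> A) (K : R) q :
  (forall x, rnorm (x - q) <= 1 -> rnorm (f x - f q) <= K * rnorm (x - q)) ->
  (forall x, rnorm (x - q) <= 1 -> rnorm (g x - g q) <= K * rnorm (x - q)) ->
  (forall e : R, 0 < e -> exists2 x, rnorm (f x - g x) <= e & rnorm (x - q) <= e) ->
  f q = g q.
Proof.
wlog K0 : K / 0 <= K => [wl fK gK|fK gK fg].
  have le x : K * rnorm (x - q) <= `|K| * rnorm (x - q).
    by rewrite ler_wpM2r ?rnorm_ge0 // ler_norm.
  apply: (wl `|K|) => // x /[dup] xq => [/fK|/gK] h; exact: le_trans (le x).
(* Going from f q to g q through f x and g x costs K e' + e' + K e'; the minimum with 1 keeps x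
   inside the Lipschitz ball. *)
apply: rnorm_eq => e e0; pose e' := Num.min 1 (e / (2 * K + 1)).
have K1 : 0 < 2 * K + 1 by lra.
have [|x fgx xq] := fg e'; first by rewrite lt_min ltr01 divr_gt0.
have /fK fx : rnorm (x - q) <= 1 by rewrite (le_trans xq) // ge_min lexx.
have /gK gx : rnorm (x - q) <= 1 by rewrite (le_trans xq) // ge_min lexx.
have e'e : (2 * K + 1) * e' <= e.
  by rewrite mulrC -ler_pdivlMr // ge_min lexx orbT.
have := rnorm_tri (f x) (f q) (g q); have := rnorm_tri (g x) (f x) (g q).
have Kx : K * rnorm (x - q) <= K * e' by rewrite ler_wpM2l.
by rewrite (rnorm_dist (f q) (f x)); lra.
Qed.

(** The defects of the Newton iterates at least halve at each step, so the increments are at most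
    5/64 2^-n and the iterates converge. Each iterate is self-adjoint and inherits the relations uz
    = u and zw = z, which then pass to the limit. *)
Lemma projection_of_almost_idempotent z :
  cstar z = z -> rnorm (newton_defect z) <= 64^-1 ->
  exists q, [/\ projection q, forall u, u ** z = u -> u ** q = u &
                forall w, z ** w = z -> q ** w = q].
Proof.
move=> sz dz; pose x n := iter n newton z.
have xs n : cstar (x n) = x n by elim: n => //= n; exact: newton_cstar.
have dx n : rnorm (newton_defect (x n)) <= 64^-1 * 2^-1 ^+ n.
  elim: n => [|n IH]; first by rewrite expr0 mulr1.
  have n1 : (2^-1 : R) ^+ n <= 1 by rewrite exprn_ile1 ?invr_ge0 ?invf_le1 // ler1n.
  have [] := newton_estimate _ (xs n); first by lra.
  by rewrite /= exprSr => _; lra.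
have [q xq] : exists q, forall e : R, 0 < e ->
    exists N, forall n, (N <= n)%N -> rnorm (x n - q) < e.
  apply: rnorm_geometric_complete => n /=; have := dx n.
  have n0 : 0 <= (2^-1 : R) ^+ n by rewrite exprn_ge0 ?invr_ge0.
  have n1 : (2^-1 : R) ^+ n <= 1 by rewrite exprn_ile1 ?invr_ge0 ?invf_le1 // ler1n.
  move=> dn; have [|+ _] := newton_estimate _ (xs n); lra.
have xq' (e : R) (P : A -> Prop) : 0 < e -> (forall n, P (x n)) ->
    exists2 y, P y & rnorm (y - q) <= e.
  by move=> /xq[N /(_ N (leqnn N))/ltW xN] Px; exists (x N).
have sq : cstar q = q.
  apply: (locally_lipschitz_eq cstar id 1) => [y _|y _|e e0].
  - by rewrite -cstarB rnorm_cstar mul1r.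
  - by rewrite mul1r.
  - by apply: xq' => // n; rewrite xs subrr /rnorm normr0 ltW.
have qq : q ** q = q.
  have q0 := rnorm_ge0 q.
  apply: (locally_lipschitz_eq (fun y => y ** y) id (1 + 2 * rnorm q))
    => [y yq|y _|e e0].
  - by rewrite mulrC rnorm_sqr_dist.
  - by rewrite ler_peMl ?rnorm_ge0 //; lra.
  (* Idempotence holds only in the limit, so the iterate must be late enough both for a small defect
     ([N]) and for closeness to q ([N']). *)
  - have [N /ltW le] := half_pow_lt 64^-1 e e0.
    have [N' xN'] := xq _ e0; pose n := maxn N N'.
    exists (x n); last by rewrite ltW ?xN' ?leq_maxr.
    apply: le_trans (dx n) (le_trans _ le).
    by rewrite ler_wpM2l ?ler_wiXn2l ?leq_maxl ?invr_ge0 ?invf_le1 ?ler1n.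
exists q; split=> // [u uz|w zw].
- have xu n : u ** x n = u by elim: n => //= n; exact: newton_fixl.
  apply: (locally_lipschitz_eq (cmul u) (fun=> u) (rnorm u)) => [y _|y _|e e0].
  + by rewrite -cmulBr rnormM.
  + by rewrite subrr {1}/rnorm normr0 mulr_ge0 ?rnorm_ge0.
  + by apply: xq' => // n; rewrite xu subrr /rnorm normr0 ltW.
- have xw n : x n ** w = x n by elim: n => //= n; exact: newton_fixr.
  have w0 := rnorm_ge0 w.
  apply: (locally_lipschitz_eq (cmul^~ w) id (1 + rnorm w)) => [y _|y _|e e0].
  + rewrite -cmulBl; apply: le_trans (rnormM _ _) _.
    by rewrite mulrC ler_wpM2r ?rnorm_ge0 //; lra.
  + by rewrite ler_peMl ?rnorm_ge0 //; lra.
  + by apply: xq' => // n; rewrite xw subrr /rnorm normr0 ltW.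
Qed.

(** * A projection between two elements of a net *)

(* In the unitization, 1 - quasi_mul a b = (1 - a) (1 - b). *)
Definition quasi_mul a b := a + b - a ** b.

Lemma quasi_mulA : associative quasi_mul.
Proof.
by move=> a b c; rewrite /quasi_mul !(cmulDl, cmulDr, cmulNl, cmulNr, cmulA); zmod.
Qed.

Lemma quasi_mul_cstar a b : cstar (quasi_mul a b) = quasi_mul (cstar b) (cstar a).
Proof. by rewrite cstarB cstarD cstarM /quasi_mul (addrC (cstar a)). Qed.

(** In the unitization, u (1 - a) = 0 implies u (1 - a) (1 - b) = 0. *)
Lemma quasi_mul_fixl u a b : u ** a = u -> u ** quasi_mul a b = u.
Proof. by move=> ua; rewrite cmulBr cmulDr cmulA ua addrK. Qed.

Lemma quasi_mul_fixr w a b : a ** w = a -> b ** w = b ->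
  quasi_mul a b ** w = quasi_mul a b.
Proof. by move=> aw bw; rewrite cmulBl cmulDl -cmulA aw bw. Qed.

Lemma rnorm_cmul_le1r a b : rnorm b <= 1 -> rnorm (a ** b) <= rnorm a.
Proof.
by move=> b1; apply: le_trans (rnormM _ _) _; rewrite ler_piMr ?rnorm_ge0.
Qed.

Lemma rnorm_cmul_le1l a b : rnorm a <= 1 -> rnorm (a ** b) <= rnorm b.
Proof.
by move=> a1; apply: le_trans (rnormM _ _) _; rewrite ler_piMl ?rnorm_ge0.
Qed.

Lemma rnorm_fix_cstar a b : cstar b = b ->
  rnorm (a - b ** a) = rnorm (cstar a - cstar a ** b).
Proof. by move=> sb; rewrite -rnorm_cstar cstarB cstarM sb. Qed.

(** As b = bp, the error a - ap equals (a - b) - (a - b) p. *)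
Lemma near_fix a b p : rnorm p <= 1 -> b ** p = b ->
  rnorm (a - a ** p) <= 2 * rnorm (a - b).
Proof.
move=> p1 bp; have -> : a - a ** p = (a - b) - (a - b) ** p.
  by rewrite cmulBl bp; zmod.
apply: le_trans (rnormB _ _) _; have := rnorm_cmul_le1r (a - b) _ p1; lra.
Qed.

(** The 44 accumulates as follows: |p - x| <= 2e, |v - vx| <= 3e, |z - x| <= 9e and |z - p| <= 11e.
    The defect of z is the difference of z^2 - p^2, at most 33e, and z - p. *)
Lemma projection_between (e : R) u v p w t : 44 * e <= 64^-1 ->
  u ** v = u -> v ** t = v -> w ** t = w ->
  positive_contraction v -> positive_contraction w -> projection p ->
  rnorm (v - v ** p) <= e -> rnorm (p - p ** w) <= e ->
  exists q, [/\ projection q, u ** q = u & q ** t = q].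
Proof.
move=> e44 uv vt wt cv cw pp vp pw.
have [sv v1] := (contraction_cstar _ cv, contraction_rnorm _ cv).
have [sw w1] := (contraction_cstar _ cw, contraction_rnorm _ cw).
have [p2 sp] := pp; have p1 := projection_rnorm _ pp.
pose x := w ** p ** w; pose y := quasi_mul v x; pose z := quasi_mul y v.
have sx : cstar x = x by rewrite !cstarM sw sp cmulA.
(* The adjoint reverses the factors of the palindrome v, x, v, and associativity of [quasi_mul]
   removes the change of bracketing. *)
have sz : cstar z = z by rewrite !quasi_mul_cstar sv sx quasi_mulA.
have uz : u ** z = u by do 2!apply: quasi_mul_fixl.
have zt : z ** t = z by do 2?apply: quasi_mul_fixr => //; rewrite -cmulA wt.
have px : rnorm (p - x) <= 2 * e.
  have -> : p - x = (p - p ** w) + (p - w ** p) ** w by rewrite cmulBl /x; zmod.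
  apply: le_trans (rnormD _ _) _.
  have := rnorm_cmul_le1r (p - w ** p) _ w1.
  by rewrite rnorm_fix_cstar // sp; lra.
clearbody x; have vx : rnorm (v - v ** x) <= 3 * e.
  have -> : v - v ** x = (v - v ** p) + v ** (p - x) by rewrite cmulBr; zmod.
  by apply: le_trans (rnormD _ _) _; have := rnorm_cmul_le1l _ (p - x) v1; lra.
have zx : rnorm (z - x) <= 9 * e.
  have -> : z - x = (v - v ** x) + ((v - x ** v) - (v - v ** x) ** v).
    by rewrite /z /y /quasi_mul !(cmulDl, cmulNl); zmod.
  have := rnorm_fix_cstar v x sx; rewrite sv => xv.
  apply: le_trans (rnormD _ _) _.
  have := rnormB (v - x ** v) ((v - v ** x) ** v).
  have := rnorm_cmul_le1r (v - v ** x) _ v1; lra.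
clearbody z; have zp : rnorm (z - p) <= 11 * e.
  by have := rnorm_tri x z p; rewrite (rnorm_dist x p); lra.
have [|q [qp fixl fixr]] := projection_of_almost_idempotent z sz; last first.
  by exists q; split; [|exact: fixl|exact: fixr].
have -> : newton_defect z = (z ** z - p ** p) - (z - p).
  by rewrite p2 /newton_defect; zmod.
apply: le_trans (rnormB _ _) _.
have h : rnorm (z ** z - p ** p) <= rnorm (z - p) * (1 + 2 * rnorm p).
  by apply: rnorm_sqr_dist; lra.
have := rnorm_ge0 (z - p); move: h; move: (rnorm (z ** z - _)) => s; nra.
Qed.

(** * Corners and units of subalgebras *)

(** This is pAp for a projection p, described by equations rather than as an image so that
    closedness follows by passing to the limit. *)
Definition corner p : set A := [set a | p ** a = a /\ a ** p = a].

Lemma closed_rnorm (B : set A) :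
  (forall a, (forall e : R, 0 < e -> exists2 b, B b & rnorm (b - a) <= e) -> B a) ->
  closed B.
Proof.
move=> h a /= aB; apply: h => e e0.
have [|b [Bb]] := aB (ball a e%:C); first by apply: nbhsx_ballx; rewrite ltcR.
by rewrite -ball_normE /= normE ltcR rnorm_dist => /ltW; exists b.
Qed.

Lemma dense_rnorm (B : set A) :
  dense B <-> forall a (e : R), 0 < e -> exists2 b, B b & rnorm (a - b) < e.
Proof.
split=> [dB a e e0|h O [a Oa] oO].
  have [||b [ab Bb]] := dB (ball a e%:C).
  - by exists a; apply: ballxx; rewrite ltcR.
  - exact: ball_open.
  - by exists b => //; move: ab; rewrite -ball_normE /= normE ltcR.
have /nbhs_ballP[e /=] := open_nbhs_nbhs (conj oO Oa).
rewrite ltcE => /andP[e1 e0] sub.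
have [b Bb ab] := h a _ e0; exists b; split=> //; apply: sub.
by rewrite -ball_normE /= normE ltcE /= e1.
Qed.

Lemma corner_unital p : projection p -> unital_cstar_subalgebra (corner p).
Proof.
move=> pp; have [p2 sp] := pp; have p1 := projection_rnorm _ pp.
split; last first.
  by exists p => [|b []]; [split|].
split.
- apply: closed_rnorm => a ha; split.
  + apply: (locally_lipschitz_eq (cmul p) id 1) => [y _|y _|e /ha[b [pb bp] ba]].
    * by rewrite mul1r -cmulBr rnorm_cmul_le1l.
    * by rewrite mul1r.
    * by exists b => //; rewrite pb subrr /rnorm normr0 (le_trans _ ba) ?rnorm_ge0.
  + apply: (locally_lipschitz_eq (cmul^~ p) id 1) => [y _|y _|e /ha[b [pb bp] ba]].
    * by rewrite mul1r -cmulBl rnorm_cmul_le1r.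
    * by rewrite mul1r.
    * by exists b => //; rewrite bp subrr /rnorm normr0 (le_trans _ ba) ?rnorm_ge0.
- by split; rewrite (cmul0l, cmul0r).
- move=> k a b [pa ap] [pb bp].
  by split; rewrite (cmulDr, cmulDl) (cmulZr, cmulZl) ?pa ?ap ?pb ?bp.
- by move=> a b [pa ap] [pb bp]; split; rewrite ?cmulA ?pa // -cmulA bp.
- by move=> a [pa ap]; split; rewrite -{1}sp -cstarM ?ap ?pa.
Qed.

Lemma corner_cmul p a : p ** p = p -> corner p (p ** a ** p).
Proof. by move=> pp; split; rewrite -?cmulA ?pp // !cmulA pp. Qed.

(** Split a - pap as (a - ap) + (a - pa) p. The error of multiplying on the left is that of
    multiplying the adjoint on the right, which is what an approximate unit controls. *)
Lemma near_corner p a : projection p ->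
  rnorm (a - p ** a ** p) <= rnorm (a - a ** p) + rnorm (cstar a - cstar a ** p).
Proof.
move=> pp; rewrite -rnorm_fix_cstar; last by case: pp.
have -> : a - p ** a ** p = (a - a ** p) + (a - p ** a) ** p.
  by rewrite cmulBl; zmod.
by apply: le_trans (rnormD _ _) _; rewrite lerD2l rnorm_cmul_le1r ?projection_rnorm.
Qed.

(** Since p* lies in B, p p* = p*; taking adjoints gives p p* = p. *)
Lemma unit_projection (B : set A) p : cstar_subalgebra B -> B p ->
  (forall b, B b -> p ** b = b /\ b ** p = b) -> projection p.
Proof.
case=> _ _ _ _ Bs Bp pB; have [p2 _] := pB _ Bp; split=> //.
have [psp _] := pB _ (Bs _ Bp).
by have := congr1 (@cstar R A) psp; rewrite cstarM cstarK psp.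
Qed.

Lemma unital_projection (B : set A) : unital_cstar_subalgebra B ->
  exists p, [/\ projection p, B p & forall b, B b -> p ** b = b /\ b ** p = b].
Proof. by case=> sB [p Bp pB]; exists p; split=> //; exact: unit_projection pB. Qed.

Lemma ll_trans a b c : ll a b -> ll b c -> ll a c.
Proof. by rewrite /ll => ab bc; rewrite {2}ab -cmulA -bc. Qed.

(** * From nets of projections to unital subalgebras *)

Section Nets.
Variables (L : Type) (prec : L -> L -> Prop) (u : L -> A).

Lemma cvg_tailsP a :
  `|a - a ** u l| @[l --> tails prec] --> (0 : (R[i] : numFieldType)) <->
  forall e : R, 0 < e ->
    exists l0, forall l, prec l0 l -> rnorm (a - a ** u l) < e.
Proof.
split=> [h e e0|h P].
  have [|l0 _ sub] := h (ball 0 e%:C); first by apply: nbhsx_ballx; rewrite ltcR.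
  exists l0 => l /sub /=.
  by rewrite -ball_normE /= sub0r normrN normr_id normE ltcR.
case/nbhs_ballP => e /=; rewrite ltcE => /andP[e1 e0] sub.
have [l0 hl] := h _ e0; exists l0 => // l /= /hl al; apply: sub.
by rewrite -ball_normE /= sub0r normrN normr_id normE ltcE /= e1.
Qed.

Lemma approximate_unitP : approximate_unit prec u <->
  [/\ directed_rel prec, forall l, positive_contraction (u l) &
      forall a (e : R), 0 < e ->
        exists l0, forall l, prec l0 l -> rnorm (a - a ** u l) < e].
Proof. by split=> -[d c h]; split=> // a; exact/cvg_tailsP/h. Qed.

Lemma approximate_unit_seq (s : seq A) (e : R) : approximate_unit prec u -> 0 < e ->
  exists l0, forall l, prec l0 l -> forall a, a \in s -> rnorm (a - a ** u l) < e.
Proof.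
case/approximate_unitP=> -[tr dir] _ h e0; elim: s => [|a s [l0 IH]].
  (* For the empty list any index will do; convergence at 0 provides one. *)
  by have [l0 _] := h 0 _ e0; exists l0.
have [l1 h1] := h a _ e0; have [l2 [p0 p1]] := dir l0 l1.
exists l2 => l p2 b; rewrite inE => /orP[/eqP->|]; first exact/h1/(tr _ _ _ p1).
by apply: IH; exact: (tr _ _ _ p0).
Qed.

Lemma locally_unital_of_projections :
  approximate_unit prec u -> (forall l, projection (u l)) -> locally_unital A.
Proof.
move=> au pu F eps /finite_seqP[s ->] eps0.
have [|l0 hl] := approximate_unit_seq (s ++ map (@cstar _ A) s) (eps / 2) au.
  by rewrite divr_gt0.
have /approximate_unitP[[_ dir] _ _] := au.
(* The relation need not be reflexive, so an index beyond [l0] comes from directedness. *)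
have [l [l0l _]] := dir l0 l0; have pl := pu l.
exists (corner (u l)); first exact: corner_unital.
move=> f /= fs; exists (u l ** f ** u l); first by apply: corner_cmul; case: pl.
rewrite normE ltcR; apply: le_lt_trans (near_corner _ _ pl) _.
have : rnorm (f - f ** u l) < eps / 2 by apply: hl; rewrite // mem_cat fs.
have : rnorm (cstar f - cstar f ** u l) < eps / 2.
  by apply: hl; rewrite // mem_cat map_f ?orbT.
by move: (rnorm _) (rnorm _) => x y; lra.
Qed.

Lemma almost_unital_of_projections :
  approximate_unit prec u -> ll_increasing prec u -> (forall l, projection (u l)) ->
  almost_unital A.
Proof.
move=> au inc pu; have /approximate_unitP[[_ dir] _ _] := au.
have sub l m : prec l m -> corner (u l) `<=` corner (u m).
  (* The adjoint of [u l = u l ** u m] gives the same relation on the other side. *)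
  move=> /inc lm a [la al]; have ml : u m ** u l = u l.
    have [[_ sl] [_ sm]] := (pu l, pu m).
    by have := congr1 (@cstar R A) lm; rewrite cstarM sl sm => <-.
  by split; [rewrite -la cmulA ml|rewrite -al -cmulA -lm].
exists [set B | exists l, B = corner (u l)]; split.
- by move=> _ [l ->]; exact: corner_unital.
- move=> _ _ [l ->] [m ->]; have [n [ln mn]] := dir l m.
  by exists (corner (u n)); split; [exists n|exact: sub|exact: sub].
- apply/dense_rnorm => a e e0.
  have [|l0 hl] := approximate_unit_seq [:: a; cstar a] (e / 2) au.
    by rewrite divr_gt0.
  have [l [l0l _]] := dir l0 l0; exists (u l ** a ** u l).
    by exists (corner (u l)); [exists l|apply: corner_cmul; case: (pu l)].
  apply: le_lt_trans (near_corner _ _ (pu l)) _.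
  have : rnorm (a - a ** u l) < e / 2 by apply: hl; rewrite // !inE eqxx.
  have : rnorm (cstar a - cstar a ** u l) < e / 2.
    by apply: hl; rewrite // !inE eqxx orbT.
  by move: (rnorm _) (rnorm _) => x y; lra.
Qed.

End Nets.

(** * From unital subalgebras to nets of projections *)

(** The index set consists of pairs of a finite list and a precision n. The projection attached to a
    pair is the unit of a subalgebra that approximates the list within 2^-n, and [near_fix] doubles
    this error. *)
Lemma locally_unital_projections : locally_unital A ->
  exists (L : Type) (prec : L -> L -> Prop) (u : L -> A),
    approximate_unit prec u /\ (forall l, projection (u l)).
Proof.
move=> lu.
have /choice[u hu] : forall l : seq A * nat, exists p, projection p /\
    forall f, f \in l.1 -> rnorm (f - f ** p) <= 2 * 2^-1 ^+ l.2.
  move=> [s n]; have [||B uB Bs] := lu [set` s] (2^-1 ^+ n).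
  - exact: finite_seq.
  - by rewrite exprn_gt0 ?invr_gt0.
  have [p [pp Bp pB]] := unital_projection _ uB.
  exists p; split=> // f /Bs[b /pB[_ bp]]; rewrite normE ltcR => fb.
  apply: le_trans (near_fix _ _ _ (projection_rnorm _ pp) bp) _.
  by rewrite ler_pM2l // ltW.
exists (seq A * nat)%type, (fun l m => {subset l.1 <= m.1} /\ (l.2 <= m.2)%N), u.
split=> [|l]; last by have [] := hu l.
apply/approximate_unitP; split.
- split=> [l m n [lm lm'] [mn mn']|l m].
    by split; [move=> x /lm /mn|exact: leq_trans mn'].
  exists (l.1 ++ m.1, maxn l.2 m.2).
  by split; split=> /= [x|]; rewrite ?leq_maxl ?leq_maxr // mem_cat => ->; rewrite ?orbT.
- by move=> l; apply: projection_contraction; have [] := hu l.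
- move=> a e e0; have [N Ne] := half_pow_lt 2 e e0.
  exists ([:: a], N) => l [al Nl]; have [_ /(_ a)] := hu l.
  move=> /(_ (al _ (mem_head _ _))) h; apply: le_lt_trans h (le_lt_trans _ Ne).
  by rewrite ler_wpM2l // ler_wiXn2l // ?invr_ge0 ?invf_le1 ?ler1n.
Qed.

(** The family, ordered by inclusion, indexes its own units. If B lies in C, then 1_C fixes every
    element of B, in particular 1_B and the approximants found in B. *)
Lemma almost_unital_projections : almost_unital A ->
  exists (L : Type) (prec : L -> L -> Prop) (u : L -> A),
    [/\ approximate_unit prec u, ll_increasing prec u &
        forall l, projection (u l)].
Proof.
case=> F [uF dF /dense_rnorm cF].
have /choice[u hu] : forall l : {B | F B}, exists p, [/\ projection p, (sval l) p &
    forall b, sval l b -> p ** b = b /\ b ** p = b].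
  by case=> B FB; exact/unital_projection/uF.
exists {B | F B}, (fun l m : {B | F B} => sval l `<=` sval m), u; split; last 2 first.
- by move=> l m lm; have [_ /lm ul _] := hu l; have [_ _ /(_ _ ul)[_ /esym]] := hu m.
- by move=> l; have [] := hu l.
apply/approximate_unitP; split.
- split=> [l m n lm mn|[B FB] [C FC]]; first exact: subset_trans mn.
  by have [D [FD BD CD]] := dF _ _ FB FC; exists (exist _ D FD).
- by move=> l; apply: projection_contraction; have [] := hu l.
- move=> a e e0; have [|b [B FB Bb] ab] := cF a (e / 2); first by rewrite divr_gt0.
  exists (exist _ B FB) => l /= /(_ _ Bb) lb; have [pl _ /(_ _ lb)[_ bl]] := hu l.
  by apply: le_lt_trans (near_fix _ _ _ (projection_rnorm _ pl) bl) _; lra.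
Qed.

Lemma increasing_projections : locally_unital A ->
  (exists (L : Type) (prec : L -> L -> Prop) (u : L -> A),
    approximate_unit prec u /\ ll_increasing prec u) ->
  exists (L : Type) (prec : L -> L -> Prop) (u : L -> A),
    [/\ approximate_unit prec u, ll_increasing prec u &
        forall l, projection (u l)].
Proof.
move=> /locally_unital_projections[K [precK [p [/approximate_unitP[dK cK hK] pp]]]].
case=> L [prec [u [/approximate_unitP[[tr dir] cu hu] inc]]].
have between l : exists q, [/\ projection q, ll (u l) q & exists k, ll q (u k)].
  pose e : R := 44^-1 * 64^-1; have e0 : 0 < e by rewrite mulr_gt0 ?invr_gt0.
  have [m [lm _]] := dir l l.
  (* The projection must be chosen after [m] and before [n]: it almost fixes [u m], and [u n] in
     turn almost fixes it. *)
  have [i0 hi] := hK (u m) _ e0; have [i [/hi mi _]] := dK.2 i0 i0.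
  have [n0 hn] := hu (p i) _ e0; have [n [/hn ni mn]] := dir n0 m.
  have [k [nk _]] := dir n n.
  have [|||||||||q [qp ql qk]] := projection_between e (u l) (u m) (p i) (u n) (u k).
  - by rewrite /e; lra.
  - exact/esym/inc.
  - exact/esym/inc/(tr _ _ _ mn).
  - exact/esym/inc.
  - exact: cu.
  - exact: cu.
  - exact: pp.
  - exact: ltW.
  - exact: ltW.
  by exists q; split=> //; exists k.
pose Q := {q | projection q /\ exists k, ll q (u k)}.
exists Q, (fun q r : Q => ll (sval q) (sval r)).
exists sval; split=> [|//|[q []] //].
apply/approximate_unitP; split.
- split=> [q r s|[q [qp [k qk]]] [r [rp [m rm]]]]; first exact: ll_trans.
  (* With n beyond both k and m, q << u_k << u_n << s and likewise r << u_m << u_n << s. *)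
  have [n [/inc kn /inc mn]] := dir k m; have [s [sp ns sk]] := between n.
  exists (exist _ s (conj sp sk)); split; apply: ll_trans ns.
    exact: ll_trans kn.
  exact: ll_trans mn.
- by move=> q; apply: projection_contraction; case: (svalP q).
- move=> a e e0; have [|l0 hl] := hu a (e / 2); first by rewrite divr_gt0.
  have [l [/hl al _]] := dir l0 l0; have [q [qp lq qk]] := between l.
  exists (exist _ q (conj qp qk)) => -[r [rp rk]] /= qr.
  (* From u_l << q << r, r fixes a u_l, which is within e/2 of a. *)
  have lr : a ** u l ** r = a ** u l by rewrite -cmulA -(ll_trans _ _ _ lq qr).
  by apply: le_lt_trans (near_fix _ _ _ (projection_rnorm _ rp) lr) _; lra.
Qed.

End CStar.

Theorem theorem1p8 (R : realType) (A : cstarAlgType R) :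
  (locally_unital A <->
     exists (L : Type) (prec : L -> L -> Prop) (u : L -> A),
       approximate_unit prec u /\ (forall l, projection (u l))) /\
  (almost_unital A <->
     exists (L : Type) (prec : L -> L -> Prop) (u : L -> A),
       [/\ approximate_unit prec u, ll_increasing prec u &
           forall l, projection (u l)]) /\
  (almost_unital A <->
     locally_unital A /\
     exists (L : Type) (prec : L -> L -> Prop) (u : L -> A),
       approximate_unit prec u /\ ll_increasing prec u).
Proof.
have au_of : (exists (L : Type) (prec : L -> L -> Prop) (u : L -> A),
    [/\ approximate_unit prec u, ll_increasing prec u & forall l, projection (u l)]) ->
    almost_unital A.
  by case=> L [prec [u [au inc pu]]]; exact: (almost_unital_of_projections _ _ L prec u).
split; [split|split; split] => //.
- exact: locally_unital_projections.
- by case=> L [prec [u [au pu]]]; exact: (locally_unital_of_projections _ _ L prec u).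
- exact: almost_unital_projections.
- move=> /almost_unital_projections[L [prec [u [au inc pu]]]].
  split; first exact: (locally_unital_of_projections _ _ L prec u).
  by exists L, prec, u.
- by case=> lu inc; exact/au_of/increasing_projections.
Qed.
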